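(* Let $H$ be a Hopf algebra over a field $\Bbbk$ and let $B$ be a left $s$-unital algebra which is a partial $H$-module algebra. Let $\underline{B\# H}$ be the partial smash product. (1) If $M$ is a unital left $\underline{B\# H}$-module, then $M$ is a partial $(B,H)$-module. (2) If $M$ is a partial $(B,H)$-module, then $M$ is a unital left $\underline{B\# H}$-module. Here in (1) the structure on $M$ is $bm:=(b\#1_H)\triangleright m$ and $hm:=\left(\sum h_{(1)}\cdot x\# h_{(2)}\right)\triangleright m$ for any $x\in B$ with $xm=m$; in (2) the structure is $\left(\sum a(h_{(1)}\cdot b)\# h_{(2)}\right)\triangleright m:=a(h(bm))$.
   Context: $\Bbbk$ is a field; algebras are associative $\Bbbk$-algebras, not necessarily unital; $\Delta(h)=\sum h_{(1)}\otimes h_{(2)}$. A partial action of $H$ on an algebra $B$ is a linear map $\cdot:H\otimes B\to B$ such that for all $a,b\in B$, $h,k\in H$: $1_H\cdot a=a$ and $h\cdot(a(k\cdot b))=\sum(h_{(1)}\cdot a)(h_{(2)}k\cdot b)$; then $B$ is called a partial $H$-module algebra. The smash product $B\#H$ is the vector space $B\otimes H$ (elements written $a\#h$) with the associative product $(a\#h)(b\#k)=\sum a(h_{(1)}\cdot b)\#h_{(2)}k$. The partial smash product is the subalgebra $\underline{B\#H}=(B\#H)(B\#1_H)$, spanned by the elements $\sum a(h_{(1)}\cdot b)\#h_{(2)}$ with $a,b\in B$, $h\in H$. $B$ is left $s$-unital if for each $b\in B$ there is $x\in B$ with $xb=b$. A left module $M$ over an algebra $R$ is unital if $RM=M$. A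 partial $(B,H)$-module is a unital left $B$-module $M$ with a linear map $H\otimes M\to M$, $h\otimes m\mapsto hm$, such that $1_Hm=m$ and $h(a(km))=\sum(h_{(1)}\cdot a)((h_{(2)}k)m)$ for all $h,k\in H$, $a\in B$, $m\in M$. *)

(* Defs.v *)
From HB Require Import structures.
From mathcomp Require Import all_boot all_order all_algebra.
From mathcomp Require Import boolp.

Set Implicit Arguments.
Unset Strict Implicit.
Unset Printing Implicit Defensive.

Import GRing.Theory.
Local Open Scope ring_scope.
Local Open Scope quotient_scope.

Reserved Notation "u ⊗ v" (at level 39, left associativity).
Reserved Notation "x ** y" (at level 40, left associativity).
Reserved Notation "\Delta_( h1 , h2 <- h ) E"
  (at level 41, E at level 41, h at level 50, h1 name, h2 name,
   format "'[' \Delta_( h1 ,  h2  <-  h ) '/  '  E ']'").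

Section LinearFun.
Variables (k : fieldType) (V W : lmodType k) (f : V -> W).
Hypothesis f_lin : linear f.

Lemma linf0 : f 0 = 0.
Proof. by have := f_lin (-1) 0 0; rewrite scaler0 addr0 scaleN1r addNr. Qed.

Lemma linfD : {morph f : x y / x + y}.
Proof. by move=> x y; have := f_lin 1 x y; rewrite !scale1r. Qed.

Lemma linfZ a : {morph f : x / a *: x}.
Proof. by move=> x; have := f_lin a x 0; rewrite linf0 !addr0. Qed.

End LinearFun.

Section Tensor.
Variables (k : fieldType) (U V : lmodType k).
Implicit Types (s t : seq (U * V)) (u : U) (v : V).

(* A list [:: (u1, v1); ..; (un, vn)] stands for the formal sum of the        *)
(* ui ⊗ vi. Formal sums are identified by the congruence (for concatenation)  *)
(* generated by commutativity and the bilinearity relations. No formal        *)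
(* coefficients or opposites are needed: scalars are absorbed by U.           *)
Inductive tcong : seq (U * V) -> seq (U * V) -> Prop :=
| tcong_refl s : tcong s s
| tcong_sym s t : tcong s t -> tcong t s
| tcong_trans t s r : tcong s t -> tcong t r -> tcong s r
| tcong_cat s s' t t' : tcong s s' -> tcong t t' -> tcong (s ++ t) (s' ++ t')
| tcong_catC s t : tcong (s ++ t) (t ++ s)
| tcong_Dl u u' v : tcong [:: (u + u', v)] [:: (u, v); (u', v)]
| tcong_Dr u v v' : tcong [:: (u, v + v')] [:: (u, v); (u, v')]
| tcong_Z a u v : tcong [:: (a *: u, v)] [:: (u, a *: v)]
| tcong_0 v : tcong [:: (0, v)] [::].

Definition tcongb : rel (seq (U * V)) := fun s t => `[< tcong s t >].

Lemma tcongb_equiv : equiv_class_of tcongb.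
Proof.
split=> [s|s t|t s r]; first by apply/asboolP; exact: tcong_refl.
- by apply/asboolP/asboolP; exact: tcong_sym.
- by move=> /asboolP st /asboolP tr; apply/asboolP; exact: tcong_trans st tr.
Qed.

Canonical tcongb_rel := EquivRelPack tcongb_equiv.
Canonical tcongb_encModRel := defaultEncModRel tcongb.

Definition tensor := {eq_quot tcongb}.

HB.instance Definition _ := Choice.on tensor.
HB.instance Definition _ := EqQuotient.on tensor.

Definition tcls s : tensor := \pi_tensor s.
Definition tens u v : tensor := tcls [:: (u, v)].

Lemma tcls_eq s t : tcls s = tcls t <-> tcong s t.
Proof.
split=> [/eqP|st]; first by rewrite eqmodE => /asboolP.
by apply/eqP; rewrite eqmodE; apply/asboolP.
Qed.

Lemma tcls_repr (x : tensor) : tcls (repr x) = x.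
Proof. exact: reprK. Qed.

Lemma repr_tcls s : tcong (repr (tcls s)) s.
Proof. by apply/tcls_eq; rewrite tcls_repr. Qed.

Let sc (a : k) s := [seq (a *: p.1, p.2) | p <- s].

Lemma tcong_sc a s t : tcong s t -> tcong (sc a s) (sc a t).
Proof.
elim=> {s t} [s|s t _ IH|t s r _ IH1 _ IH2|s s' t t' _ IH1 _ IH2|s t|u u' v
             |u v v'|b u v|v] /=.
- exact: tcong_refl.
- exact: tcong_sym.
- exact: tcong_trans IH1 IH2.
- by rewrite /sc !map_cat; exact: tcong_cat.
- by rewrite /sc !map_cat; exact: tcong_catC.
- by rewrite scalerDr; exact: tcong_Dl.
- exact: tcong_Dr.
- by rewrite scalerA mulrC -scalerA; exact: tcong_Z.
- by rewrite scaler0; exact: tcong_0.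
Qed.

Definition tzero : tensor := tcls [::].
Definition tadd (x y : tensor) : tensor := tcls (repr x ++ repr y).
Definition tscale (a : k) (x : tensor) : tensor := tcls (sc a (repr x)).
Definition topp (x : tensor) : tensor := tscale (-1) x.

Lemma tadd_cls s t : tadd (tcls s) (tcls t) = tcls (s ++ t).
Proof. by apply/tcls_eq/tcong_cat; exact: repr_tcls. Qed.

Lemma tscale_cls a s : tscale a (tcls s) = tcls (sc a s).
Proof. by apply/tcls_eq/tcong_sc; exact: repr_tcls. Qed.

Lemma taddA : associative tadd.
Proof.
move=> x y z; rewrite -[x]tcls_repr -[y]tcls_repr -[z]tcls_repr.
by rewrite !tadd_cls catA.
Qed.

Lemma taddC : commutative tadd.
Proof.
move=> x y; rewrite -[x]tcls_repr -[y]tcls_repr !tadd_cls.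
by apply/tcls_eq; exact: tcong_catC.
Qed.

Lemma tadd0 : left_id tzero tadd.
Proof. by move=> x; rewrite -[x]tcls_repr tadd_cls. Qed.

Lemma tscaleDl x : {morph tscale^~ x : a b / a + b >-> tadd a b}.
Proof.
move=> a b; rewrite -[x]tcls_repr !tscale_cls tadd_cls; apply/tcls_eq.
elim: (repr x) => [|[u v] s IH] /=; first exact: tcong_refl.
apply: (tcong_trans (t := [:: (a *: u, v); (b *: u, v)] ++ (sc a s ++ sc b s))).
  by rewrite -cat1s; apply: tcong_cat => //; rewrite scalerDl; exact: tcong_Dl.
rewrite -cat_rcons -cats1.
change (tcong ([:: (a *: u, v)] ++ (([:: (b *: u, v)] ++ sc a s) ++ sc b s))
  ([:: (a *: u, v)] ++ ((sc a s ++ [:: (b *: u, v)]) ++ sc b s))).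
apply: tcong_cat; first exact: tcong_refl.
by apply: tcong_cat; [exact: tcong_catC | exact: tcong_refl].
Qed.

Lemma tscaleDr : right_distributive tscale tadd.
Proof.
move=> a x y; rewrite -[x]tcls_repr -[y]tcls_repr tadd_cls !tscale_cls.
by rewrite tadd_cls /sc map_cat.
Qed.

Lemma tscaleA a b x : tscale a (tscale b x) = tscale (a * b) x.
Proof.
rewrite -[x]tcls_repr !tscale_cls /sc -map_comp; congr tcls.
by apply: eq_map => p /=; rewrite scalerA.
Qed.

Lemma tscale1 : left_id 1 tscale.
Proof.
move=> x; rewrite -[x in RHS]tcls_repr /tscale /sc; congr tcls.
by rewrite -[RHS]map_id; apply: eq_map => -[u v] /=; rewrite scale1r.
Qed.

Lemma taddN : left_inverse tzero topp tadd.
Proof.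
move=> x; rewrite -{2}[x]tscale1 /topp -tscaleDl addNr.
rewrite -[x]tcls_repr tscale_cls; apply/tcls_eq.
elim: (repr x) => [|[u v] s IH] /=; first exact: tcong_refl.
rewrite -cat1s -[[::]]cats0; apply: tcong_cat => //.
by rewrite scale0r; exact: tcong_0.
Qed.

HB.instance Definition _ :=
  GRing.isZmodule.Build tensor taddA taddC tadd0 taddN.
HB.instance Definition _ :=
  GRing.Zmodule_isLmodule.Build k tensor tscaleA tscale1 tscaleDr
    (fun x a b => tscaleDl x a b).

Lemma tclsD s t : tcls s + tcls t = tcls (s ++ t).
Proof. exact: tadd_cls. Qed.

Lemma tclsZ a s : a *: tcls s = tcls [seq (a *: p.1, p.2) | p <- s].
Proof. exact: tscale_cls. Qed.

Lemma tens_bilinear : bilinear_for *:%R *:%R tens.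
Proof.
split=> [v a u u'|u a v v']; rewrite /tens /= tclsZ tclsD /=; apply/tcls_eq.
  exact: tcong_Dl.
apply: tcong_trans (tcong_Dr _ _ _) _.
rewrite -cat1s -[X in tcong _ X]cat1s; apply: tcong_cat; last exact: tcong_refl.
by apply: tcong_sym; exact: tcong_Z.
Qed.

HB.instance Definition _ :=
  @bilinear_isBilinear.Build k U V tensor *:%R *:%R tens tens_bilinear.

Lemma tens_sum (x : tensor) : x = \sum_(p <- repr x) tens p.1 p.2.
Proof.
rewrite -[x in LHS]tcls_repr; elim: (repr x) => [|[u v] s IH].
  by rewrite big_nil.
by rewrite big_cons -IH /tens tclsD.
Qed.

Lemma tens_eq_linear (W : lmodType k) (f g : tensor -> W) :
  linear f -> linear g -> (forall u v, f (tens u v) = g (tens u v)) -> f =1 g.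
Proof.
move=> fL gL fg x; rewrite (tens_sum x); elim: (repr x) => [|p s IH].
  by rewrite big_nil !linf0.
by rewrite big_cons -[tens _ _]scale1r fL gL IH fg.
Qed.

(* The linear map U ⊗ V -> W induced by f: it sends the sum of the ui ⊗ vi to *)
(* the sum of the f ui vi. It is total in f, but it is computed on a chosen   *)
(* representative and is meaningful only for bilinear f, see tliftE.          *)
Definition tlift (W : lmodType k) (f : U -> V -> W) (x : tensor) : W :=
  \sum_(p <- repr x) f p.1 p.2.

Section Tlift.
Variable W : lmodType k.
Implicit Type f : U -> V -> W.

Lemma tcong_sum f s t : bilinear_for *:%R *:%R f -> tcong s t ->
  \sum_(p <- s) f p.1 p.2 = \sum_(p <- t) f p.1 p.2.
Proof.
move=> [fl fr].
elim=> {s t} [s|s t _ IH|t s r _ IH1 _ IH2|s s' t t' _ IH1 _ IH2|s t|u u' v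
             |u v v'|b u v|v] //=.
- by rewrite IH1.
- by rewrite !big_cat /= IH1 IH2.
- by rewrite !big_cat /= addrC.
- by rewrite !big_cons !big_nil /= !addr0 (linfD (fl v)).
- by rewrite !big_cons !big_nil /= !addr0 (linfD (fr u)).
- by rewrite !big_cons !big_nil /= !addr0 (linfZ (fl v)) (linfZ (fr u)).
- by rewrite !big_cons !big_nil /= addr0 (linf0 (fl v)).
Qed.

Lemma tliftE f u v : bilinear_for *:%R *:%R f -> tlift f (tens u v) = f u v.
Proof.
move=> fb; rewrite /tlift (tcong_sum fb (repr_tcls _)) big_cons big_nil.
by rewrite addr0.
Qed.

Lemma tlift_linear f : bilinear_for *:%R *:%R f -> linear (tlift f).
Proof.
move=> fb a x y; rewrite {1}/tlift -[x]tcls_repr -[y]tcls_repr.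
rewrite tclsZ tclsD.
rewrite (tcong_sum fb (repr_tcls _)) big_cat /= big_map /= /tlift !tcls_repr.
congr (_ + _); rewrite scaler_sumr; apply: eq_bigr => p _.
by rewrite (linfZ (fb.1 p.2)).
Qed.

Lemma eq_tlift f g x : (forall u v, f u v = g u v) -> tlift f x = tlift g x.
Proof. by move=> fg; apply: eq_bigr => p _. Qed.

Lemma tliftP f g a x :
  tlift (fun u v => a *: f u v + g u v) x = a *: tlift f x + tlift g x.
Proof. by rewrite /tlift big_split scaler_sumr. Qed.

Lemma linear_tlift (W' : lmodType k) (g : W -> W') f x : linear g ->
  g (tlift f x) = tlift (fun u v => g (f u v)) x.
Proof. by move=> gL; exact: (big_morph g (linfD gL) (linf0 gL)). Qed.

End Tlift.
End Tensor.

Notation "u ⊗ v" := (tens u v) : ring_scope.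
Arguments tlift {k U V W} f x.

Lemma tlift_exchange (k : fieldType) (U V U' V' W : lmodType k)
    (f : U -> V -> U' -> V' -> W) (x : tensor U V) (y : tensor U' V') :
  tlift (fun u v => tlift (f u v) y) x =
  tlift (fun u' v' => tlift (fun u v => f u v u' v') x) y.
Proof. by rewrite /tlift exchange_big. Qed.

HB.mixin Record Lmodule_isNuAlgebra (k : fieldType) A of GRing.Lmodule k A := {
  numul : A -> A -> A;
  numulA : associative numul;
  numul_bilinear : bilinear_for *:%R *:%R numul
}.

#[short(type="nuAlgType")]
HB.structure Definition NuAlgebra (k : fieldType) :=
  {A of GRing.Lmodule k A & Lmodule_isNuAlgebra k A}.

Notation "x ** y" := (numul x y) : ring_scope.

HB.instance Definition _ (k : fieldType) (A : nuAlgType k) :=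
  @bilinear_isBilinear.Build k A A A *:%R *:%R (@numul k A) (@numul_bilinear k A).

Definition left_s_unital (k : fieldType) (B : nuAlgType k) : Prop :=
  forall b : B, exists x : B, x ** b = b.

Section Modules.
Variables (k : fieldType) (R : nuAlgType k) (M : lmodType k).
Implicit Type act : {bilinear R -> M -> M}.

Definition is_left_module act : Prop :=
  forall r s m, act (r ** s) m = act r (act s m).

(* RM is the additive span of the products rm. *)
Definition is_unital act : Prop :=
  forall m : M, exists s : seq (R * M), m = \sum_(p <- s) act p.1 p.2.

Definition is_unital_left_module act : Prop :=
  is_left_module act /\ is_unital act.

End Modules.

HB.mixin Record Lmodule_isCoalgebra (k : fieldType) H of GRing.Lmodule k H := {
  comul : {linear H -> tensor H H};
  counit : {scalar H};
  comulA : forall h : H,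
    tlift (fun h1 h2 => tlift (fun x y => x ⊗ (y ⊗ h2)) (comul h1)) (comul h) =
    tlift (fun h1 h2 => h1 ⊗ comul h2) (comul h);
  counitl : forall h : H, tlift (fun h1 h2 => counit h1 *: h2) (comul h) = h;
  counitr : forall h : H, tlift (fun h1 h2 => counit h2 *: h1) (comul h) = h
}.

#[short(type="coalgType")]
HB.structure Definition Coalgebra (k : fieldType) :=
  {H of GRing.Lmodule k H & Lmodule_isCoalgebra k H}.

(* Sweedler notation: the expression E, bilinear in h1 and h2, summed over    *)
(* the comultiplication of h.                                                 *)
Notation "\Delta_( h1 , h2 <- h ) E" :=
  (tlift (fun h1 h2 => E) (comul h)) : ring_scope.

HB.mixin Record isHopf (k : fieldType) H
    of GRing.Algebra k H & Coalgebra k H := {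
  comul1 : comul (1 : H) = (1 : H) ⊗ (1 : H);
  comulM : forall g h : H, comul (g * h) =
    \Delta_(g1, g2 <- g) \Delta_(h1, h2 <- h) ((g1 * h1) ⊗ (g2 * h2));
  counit_monoid : monoid_morphism (counit : H -> k);
  antipode : {linear H -> H};
  antipodel : forall h : H,
    \Delta_(h1, h2 <- h) (antipode h1 * h2) = counit h *: 1;
  antipoder : forall h : H,
    \Delta_(h1, h2 <- h) (h1 * antipode h2) = counit h *: 1
}.

#[short(type="hopfAlgType")]
HB.structure Definition Hopf (k : fieldType) :=
  {H of GRing.Algebra k H & Coalgebra k H & isHopf k H}.

(* The linear map H ⊗ B -> B is given as the corresponding bilinear map.      *)
Record partial_action (k : fieldType) (H : hopfAlgType k) (B : nuAlgType k) :=
  PartialAction {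
    pact :> {bilinear H -> B -> B};
    pact1 : forall a : B, pact 1 a = a;
    pactM : forall (h g : H) (a b : B),
      pact h (a ** pact g b) =
      \Delta_(h1, h2 <- h) (pact h1 a ** pact (h2 * g) b)
  }.

(* The vector space B ⊗ H, tagged with the partial action that determines its *)
(* product.                                                                   *)
Definition smash (k : fieldType) (H : hopfAlgType k) (B : nuAlgType k)
  (P : partial_action H B) : Type := tensor B H.

Section Smash.
Variables (k : fieldType) (H : hopfAlgType k) (B : nuAlgType k).
Variable P : partial_action H B.

HB.instance Definition _ := GRing.Lmodule.on (smash P).

Definition smash_tens (a : B) (h : H) : smash P := a ⊗ h.
Local Notation "a # h" := (smash_tens a h) (at level 39).

Definition smash_mul (x y : smash P) : smash P :=
  tlift (fun a h => tlift (fun b g =>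
    \Delta_(h1, h2 <- h) ((a ** P h1 b) # (h2 * g))) y) x.

Lemma sweedler_linear (W : lmodType k) (f : H -> H -> W) :
  bilinear_for *:%R *:%R f -> linear (fun h => \Delta_(h1, h2 <- h) f h1 h2).
Proof. by move=> fb a x y; rewrite linearP (tlift_linear fb). Qed.

Lemma sweedlerA (W : lmodType k) (F : H -> H -> H -> W) (h : H) :
  (forall y z, linear (fun x => F x y z)) ->
  (forall x, bilinear_for *:%R *:%R (F x)) ->
  \Delta_(h1, h2 <- h) \Delta_(x, y <- h1) F x y h2 =
  \Delta_(h1, h2 <- h) \Delta_(y, z <- h2) F h1 y z.
Proof.
move=> F1 F23; pose G := tlift (fun x w => tlift (F x) w).
have Gb : bilinear_for *:%R *:%R (fun x w => tlift (F x) w).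
  split=> [w a x x'|x]; last exact: tlift_linear.
  by rewrite /= -tliftP; apply: eq_tlift => y z; rewrite -F1.
have GL : linear G by exact: tlift_linear.
have := congr1 G (comulA h); rewrite !linear_tlift // => e.
transitivity (\Delta_(h1, h2 <- h) G
    (\Delta_(x, y <- h1) (x ⊗ (y ⊗ h2)))).
  apply: eq_tlift => h1 h2; rewrite linear_tlift //; apply: eq_tlift => x y.
  by rewrite /G tliftE // tliftE.
by rewrite e; apply: eq_tlift => h1 h2; rewrite /G tliftE.
Qed.

Lemma smash_tens_bilinear : bilinear_for *:%R *:%R smash_tens.
Proof. exact: tens_bilinear. Qed.

Lemma linf_comp (U V W : lmodType k) (f : V -> W) (g : U -> V) :
  linear f -> linear g -> linear (fun x => f (g x)).
Proof. by move=> fL gL a x y; rewrite gL fL. Qed.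

Let numulL (c : B) : linear (fun a : B => a ** c).
Proof. exact: numul_bilinear.1. Qed.
Let numulR (c : B) : linear (fun a : B => c ** a).
Proof. exact: numul_bilinear.2. Qed.
Let mulL (h : H) : linear (fun x : H => x * h).
Proof. by move=> a x y; rewrite mulrDl scalerAl. Qed.
Let mulR (h : H) : linear (fun x : H => h * x).
Proof. by move=> a x y; rewrite mulrDr scalerAr. Qed.
Let stL (h : H) : linear (fun a => a # h).
Proof. exact: smash_tens_bilinear.1. Qed.
Let stR (a : B) : linear (fun h => a # h).
Proof. exact: smash_tens_bilinear.2. Qed.
Let PL (a : B) : linear (fun h => P h a).
Proof. by move=> c x y; rewrite linearPl. Qed.
Let PR (h : H) : linear (fun a => P h a).
Proof. by move=> c x y; rewrite linearPr. Qed.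

Let core (a : B) (h : H) (b : B) (g : H) : smash P :=
  \Delta_(h1, h2 <- h) ((a ** P h1 b) # (h2 * g)).

Let core0_bilinear a b g :
  bilinear_for *:%R *:%R (fun h1 h2 => (a ** P h1 b) # (h2 * g)).
Proof.
split=> [h2|h1].
  by apply: (linf_comp (stL _)); apply: (linf_comp (numulR _)); exact: PL.
by apply: (linf_comp (stR _)); exact: mulL.
Qed.

Let core_bilinear1 b g : bilinear_for *:%R *:%R (fun a h => core a h b g).
Proof.
split=> [h|a]; last by apply: sweedler_linear; exact: core0_bilinear.
move=> c a a'; rewrite -tliftP; apply: eq_tlift => h1 h2.
by rewrite numulL stL.
Qed.

Let core_bilinear2 a h : bilinear_for *:%R *:%R (core a h).
Proof.
split=> [g c b b'|b c g g']; rewrite -tliftP; apply: eq_tlift => h1 h2.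
  by rewrite PR numulR stL.
by rewrite mulR stR.
Qed.

Lemma smash_mul_bilinear : bilinear_for *:%R *:%R smash_mul.
Proof.
split=> [y|x].
  apply: tlift_linear; split=> [h|a].
    by move=> c a a'; rewrite -tliftP; apply: eq_tlift => b g;
       rewrite [LHS](core_bilinear1 b g).1.
  by move=> c h h'; rewrite -tliftP; apply: eq_tlift => b g;
     rewrite [LHS](core_bilinear1 b g).2.
move=> c y y'; rewrite /smash_mul -tliftP; apply: eq_tlift => a h.
exact: (tlift_linear (core_bilinear2 a h)).
Qed.

Lemma smash_mulE a h b g : smash_mul (a # h) (b # g) =
  \Delta_(h1, h2 <- h) ((a ** P h1 b) # (h2 * g)).
Proof.
rewrite /smash_mul tliftE; first by rewrite tliftE //; exact: core_bilinear2.
split=> [h'|a'].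
  by move=> c x x'; rewrite -tliftP; apply: eq_tlift => b' g';
     rewrite [LHS](core_bilinear1 b' g').1.
by move=> c x x'; rewrite -tliftP; apply: eq_tlift => b' g';
   rewrite [LHS](core_bilinear1 b' g').2.
Qed.

Let smL y : linear (smash_mul^~ y). Proof. exact: smash_mul_bilinear.1. Qed.
Let smR x : linear (smash_mul x). Proof. exact: smash_mul_bilinear.2. Qed.

Let smash_mulA_pure a h b g c l :
  smash_mul (a # h) (smash_mul (b # g) (c # l)) =
  smash_mul (smash_mul (a # h) (b # g)) (c # l).
Proof.
pose F (x y z : H) :=
  \Delta_(g1, g2 <- g) ((a ** (P x b ** P (y * g1) c)) # (z * (g2 * l))).
transitivity (\Delta_(h1, h2 <- h) \Delta_(x, y <- h1) F x y h2).
  rewrite smash_mulE (linear_tlift _ _ (smR _)) /F.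
  under eq_tlift => g1 g2.
    rewrite smash_mulE; under eq_tlift => h1 h2.
      rewrite pactM (linear_tlift _ _ (numulR _)) (linear_tlift _ _ (stL _)).
      over.
    over.
  rewrite tlift_exchange; apply: eq_tlift => h1 h2; exact: tlift_exchange.
rewrite sweedlerA; last 2 first.
- move=> y z d x x'; rewrite /F -tliftP; apply: eq_tlift => g1 g2.
  by rewrite PL numulL numulR stL.
- move=> x; split=> [z d y y'|y d z z']; rewrite /F -tliftP;
  apply: eq_tlift => g1 g2; first by rewrite mulL PL !numulR stL.
  by rewrite mulL stR.
rewrite smash_mulE (linear_tlift _ _ (smL _)); apply: eq_tlift => h1 h2.
have cL := sweedler_linear (core0_bilinear (a ** P h1 b) c l).
rewrite smash_mulE comulM.
have bL := tlift_linear (core0_bilinear (a ** P h1 b) c l).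
rewrite (linear_tlift _ _ bL); apply: eq_tlift => y z.
rewrite (linear_tlift _ _ bL); apply: eq_tlift => g1 g2.
by rewrite tliftE ?numulA ?mulrA //; exact: core0_bilinear.
Qed.

Lemma smash_mulA : associative smash_mul.
Proof.
move=> x y z; move: x.
apply: tens_eq_linear => [||a h]; [exact: smL|
  by apply: (linf_comp (smL z)); exact: smL|].
move: y; apply: tens_eq_linear => [||b g];
  [by apply: (linf_comp (smR _)); exact: smL|
   by apply: (linf_comp (smL z)); exact: smR|].
move: z; apply: tens_eq_linear => [||c l];
  [by apply: (linf_comp (smR _)); exact: smR|exact: smR|].
exact: smash_mulA_pure.
Qed.

HB.instance Definition _ := Lmodule_isNuAlgebra.Build k (smash P)
  smash_mulA smash_mul_bilinear.

Lemma smash_numulE a h b g : (a # h) ** (b # g) =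
  \Delta_(h1, h2 <- h) ((a ** P h1 b) # (h2 * g)).
Proof. exact: smash_mulE. Qed.

(* (B # H)(B # 1), the additive span of the products x (b # 1).               *)
Definition in_psmash : pred (smash P) := fun x =>
  `[< exists s : seq (smash P * B), x = \sum_(p <- s) p.1 ** (p.2 # 1) >].

Lemma in_psmash_submod : submod_closed in_psmash.
Proof.
split; first by apply/asboolP; exists [::]; rewrite big_nil.
move=> c x y /asboolP[s ->] /asboolP[t ->]; apply/asboolP.
exists ([seq (c *: p.1, p.2) | p <- s] ++ t); rewrite big_cat big_map /=.
congr (_ + _); rewrite scaler_sumr; apply: eq_bigr => p _.
exact/esym/(linfZ (smL _)).
Qed.

HB.instance Definition _ := GRing.isSubmodClosed.Build k (smash P) in_psmash
  in_psmash_submod.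

Lemma in_psmash_mul x y :
  x \in in_psmash -> y \in in_psmash -> x ** y \in in_psmash.
Proof.
move=> _ /asboolP[s ->]; apply/asboolP; exists [seq (x ** p.1, p.2) | p <- s].
rewrite big_map (big_morph (numul x) (linfD (smR x)) (linf0 (smR x))).
by apply: eq_bigr => p _; rewrite numulA.
Qed.

Record psmash := PSmash { psval :> smash P; psvalP : psval \in in_psmash }.

HB.instance Definition _ := [isSub for psval].
HB.instance Definition _ := [Choice of psmash by <:].
HB.instance Definition _ := [SubChoice_isSubLmodule of psmash by <:].

Definition psmash_mul (x y : psmash) : psmash :=
  PSmash (in_psmash_mul (psvalP x) (psvalP y)).

Lemma psmash_mulA : associative psmash_mul.
Proof. by move=> x y z; apply: val_inj; exact: numulA. Qed.

Lemma psmash_mul_bilinear : bilinear_for *:%R *:%R psmash_mul.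
Proof.
by split=> [z c x y|z c x y]; apply: val_inj; [exact: smL|exact: smR].
Qed.

HB.instance Definition _ := Lmodule_isNuAlgebra.Build k psmash
  psmash_mulA psmash_mul_bilinear.

Definition psmash_elt (a : B) (h : H) (b : B) : smash P :=
  \Delta_(h1, h2 <- h) ((a ** P h1 b) # h2).

Lemma psmash_eltE a h b : psmash_elt a h b = (a # h) ** (b # 1).
Proof.
by rewrite smash_numulE; apply: eq_tlift => h1 h2; rewrite mulr1.
Qed.

Lemma psmash_elt_in a h b : psmash_elt a h b \in in_psmash.
Proof.
by apply/asboolP; exists [:: (a # h, b)]; rewrite big_seq1 psmash_eltE.
Qed.

Definition psmash_gen a h b : psmash := PSmash (psmash_elt_in a h b).

Lemma psmash_gen_span (x : psmash) :
  exists s : seq (B * H * B), x = \sum_(p <- s) psmash_gen p.1.1 p.1.2 p.2.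
Proof.
have [s xE] := asboolP _ (psvalP x).
have valS (t : seq (B * H * B)) :
    val (\sum_(p <- t) psmash_gen p.1.1 p.1.2 p.2) =
    \sum_(p <- t) psmash_elt p.1.1 p.1.2 p.2 by rewrite raddf_sum.
suff [t tE] : exists t : seq (B * H * B),
    psval x = \sum_(p <- t) psmash_elt p.1.1 p.1.2 p.2.
  by exists t; apply: val_inj; rewrite valS.
rewrite xE; elim: s {xE} => [|[y b] s [t IH]]; first by exists [::]; rewrite !big_nil.
exists ([seq (p, b) | p <- repr y] ++ t).
rewrite big_cons IH big_cat big_map /=; congr (_ + _).
pose c : smash P := b # 1.
rewrite {1}[y]tens_sum (big_morph (numul^~ c) (linfD (smL _)) (linf0 (smL _))).
by apply: eq_bigr => p _; rewrite psmash_eltE.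
Qed.

End Smash.

(* Linear maps out of H ⊗ M are curried, as in partial_action.                *)
Record is_partial_module (k : fieldType) (H : hopfAlgType k) (B : nuAlgType k)
    (P : partial_action H B) (M : lmodType k)
    (bact : {bilinear B -> M -> M}) (hact : {bilinear H -> M -> M}) : Prop := {
  pmod_unital : is_unital_left_module bact;
  pmod1 : forall m : M, hact 1 m = m;
  pmodM : forall (h g : H) (a : B) (m : M),
    hact h (bact a (hact g m)) =
    \Delta_(h1, h2 <- h) bact (P h1 a) (hact (h2 * g) m)
}.

(* Main.v *)
(* Write [h, x] for the sum of the (h1 . x) # h2. The partial action axiom     *)
(* gives [h, x] (a # g) = sum of the (h1 . (x a)) # (h2 g). In particular      *)
(* [h, z] (x # 1) = [h, x] when z x = x, so s-unitality puts [h, x] in the     *)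
(* partial smash product, and the value of [h, x] on m does not depend on the  *)
(* x fixing m, since any two such x have a common left local unit z. The       *)
(* module axiom for h (a (g m)) is the identity                                *)
(* [h, z] (a # g) = sum of the (h1 . a) # (h2 g) for z a = a. Conversely, a    *)
(* partial module is a module over the whole smash product by                  *)
(* (a # h) m = a (h m), whose restriction is unital because                    *)
(* ((x # 1) (x # 1)) m = m when x m = m.                                       *)
Require Import Defs.
From HB Require Import structures.
From mathcomp Require Import all_boot all_order all_algebra.
From mathcomp Require Import boolp.
Set Implicit Arguments.
Unset Strict Implicit.
Unset Printing Implicit Defensive.

Import GRing.Theory.
Local Open Scope ring_scope.

(** Finite families in [B] have a common left local unit ([left_s_unital_seq]). Given a module over
    [psmash P], [psact_indep] makes the action of [h] well defined, and the partial module law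
    becomes an identity inside the smash product ([psact_ps1M], from [smash_actM]). Conversely,
    [pmodM] yields associativity of [(a # h) m = a (h m)] on pure tensors, hence everywhere
    ([smash_module_actM]); s-unitality enters only to show that the restricted action is unital. *)

Definition bilinear_of (k : fieldType) (U V W : lmodType k) (f : U -> V -> W)
    (fb : bilinear_for *:%R *:%R f) : {bilinear U -> V -> W} :=
  HB.pack f (@bilinear_isBilinear.Build k U V W *:%R *:%R f fb).

(** * Left local units for finite families *)

Section LocalUnits.
Variables (k : fieldType) (B : nuAlgType k).
Hypothesis B_s_unital : left_s_unital B.

(** Formally [1 - (e + f - f e) = (1 - f) (1 - e)]: the factor [1 - e] kills the tail, and [1 - f]
    kills [a - e a]. *)
Lemma left_s_unital_seq (s : seq B) :
  exists x : B, forall b, b \in s -> x ** b = b.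
Proof.
elim: s => [|a s [e eP]]; first by exists 0.
have [f fP] := B_s_unital (a - e ** a).
exists (e + f - f ** e) => b; rewrite linearBl linearDl /= -numulA.
rewrite inE => /predU1P[->|/eP ->]; last by rewrite addrK.
by move: fP; rewrite linearBr => fP; rewrite -addrA fP addrC subrK.
Qed.

Variable M : lmodType k.
Variable bact : {bilinear B -> M -> M}.
Hypothesis bact_module : is_unital_left_module bact.

Lemma unital_module_local_unit (m : M) : exists x : B, bact x m = m.
Proof.
have [bactM /(_ m)[s ->]] := bact_module.
have [x xP] := left_s_unital_seq [seq p.1 | p <- s].
exists x; rewrite linear_sumr; apply: eq_big_seq => p ps.
by rewrite -bactM xP // map_f.
Qed.

End LocalUnits.

(** * Identities in the smash product *)

Section SmashProduct.
Variables (k : fieldType) (H : hopfAlgType k) (B : nuAlgType k).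
Variable P : partial_action H B.

Local Notation "a # h" := (smash_tens P a h) (at level 39).

Definition smash_act (h : H) (x : B) : smash P :=
  \Delta_(h1, h2 <- h) (P h1 x # h2).

Let smash_tens_P_bilinear x :
  bilinear_for *:%R *:%R (fun h1 h2 => P h1 x # h2).
Proof.
split=> [h2|h1] c g g' /=; last exact: (smash_tens_bilinear P).2.
by rewrite linearPl (smash_tens_bilinear P).1.
Qed.

Lemma smash_act_linear x : linear (smash_act^~ x).
Proof. exact: sweedler_linear. Qed.

Lemma smash_act1 x : smash_act 1 x = x # 1.
Proof. by rewrite /smash_act comul1 tliftE ?pact1. Qed.

Lemma smash1M a b h : (a # 1) ** (b # h) = (a ** b) # h.
Proof.
rewrite smash_numulE comul1 tliftE ?pact1 ?mul1r //.
split=> [h2|h1] c g g' /=.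
  by rewrite linearPl linearPr (smash_tens_bilinear P).1.
by rewrite mulrDl -scalerAl (smash_tens_bilinear P).2.
Qed.

Lemma smash1_smash_act a h x : (a # 1) ** smash_act h x = (a # h) ** (x # 1).
Proof.
rewrite [LHS](linear_tlift _ _ ((smash_mul_bilinear P).2 _)) smash_numulE.
by apply: eq_tlift => h1 h2; rewrite [LHS]smash1M mulr1.
Qed.

(** Coassociativity gathers [P y x ** P z a] over a single [h1], where the partial action axiom
    applies. *)
Lemma smash_actM h x a g :
  smash_act h x ** (a # g) = \Delta_(h1, h2 <- h) (P h1 (x ** a) # (h2 * g)).
Proof.
have sm := smash_mul_bilinear P; have st := smash_tens_bilinear P.
rewrite [LHS](linear_tlift _ _ (sm.1 _)).
under eq_tlift do rewrite [smash_mul _ _]smash_numulE.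
rewrite -(sweedlerA (F := fun y z h2 => (P y x ** P z a) # (h2 * g))).
(* Writing [a] as [1 . a] brings [x ** a] into the form required by [pactM]. *)
- apply: eq_tlift => h1 h2; rewrite -{2}[a](pact1 P) pactM.
  rewrite (linear_tlift _ _ (st.1 _)).
  by apply: eq_tlift => y z; rewrite mulr1.
- by move=> y z c u v; rewrite !linearPl st.1.
- move=> y; split=> [z|z] c u v /=.
    by rewrite linearPl linearPr st.1.
  by rewrite mulrDl -scalerAl st.2.
Qed.

Lemma smash_act_absorb h z x :
  z ** x = x -> smash_act h z ** (x # 1) = smash_act h x.
Proof.
by move=> zx; rewrite smash_actM zx; apply: eq_tlift => h1 h2; rewrite mulr1.
Qed.

Hypothesis B_s_unital : left_s_unital B.

Lemma smash1_in_psmash b : b # 1 \in in_psmash (P := P).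
Proof.
have [x xb] := B_s_unital b; apply/asboolP; exists [:: (x # 1, b)].
by rewrite big_seq1 smash1M xb.
Qed.

Lemma smash_act_in_psmash h x : smash_act h x \in in_psmash (P := P).
Proof.
have [z zx] := B_s_unital x; apply/asboolP; exists [:: (smash_act h z, x)].
by rewrite big_seq1 smash_act_absorb.
Qed.

(** Only finitely many left tensor factors occur in representatives of the given elements; [z] fixes
    them all. *)
Lemma smash_local_unit (s : seq (smash P)) :
  exists z : B, forall r, r \in s -> (z # 1) ** r = r.
Proof.
have [z zP] := left_s_unital_seq B_s_unital
  (flatten [seq [seq p.1 | p <- repr (r : tensor B H)] | r <- s]).
exists z => r rs; rewrite [r in LHS]tens_sum [r in RHS]tens_sum.
rewrite linear_sumr; apply: eq_big_seq => p pr.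
rewrite [LHS]smash1M zP //; apply/flatten_mapP; exists r => //.
exact: map_f.
Qed.

(** * From modules over the partial smash product to partial modules *)

Section ModuleOfSmash.
Variables (M : lmodType k) (act : {bilinear psmash P -> M -> M}).
Hypothesis act_module : is_unital_left_module act.

Definition ps1 b : psmash P := PSmash (smash1_in_psmash b).
Definition psact h x : psmash P := PSmash (smash_act_in_psmash h x).

Let actM : is_left_module act. Proof. exact: act_module.1. Qed.

Lemma psmash_bact_bilinear :
  bilinear_for *:%R *:%R (fun (b : B) m => act (ps1 b) m).
Proof.
split=> [m|b] c x y /=; last exact: linearPr.
rewrite -linearPl; congr (act _ m); apply: val_inj.
exact: (smash_tens_bilinear P).1.
Qed.

Definition psmash_bact := bilinear_of psmash_bact_bilinear.

Lemma psmash_bactE b m : psmash_bact b m = act (ps1 b) m.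
Proof. by []. Qed.

Lemma psmash_bact_local_unit m : exists x, psmash_bact x m = m.
Proof.
have [s ->] := act_module.2 m.
have [x xP] := smash_local_unit [seq psval p.1 | p <- s].
exists x; rewrite linear_sumr; apply: eq_big_seq => p ps.
rewrite [LHS]psmash_bactE -actM; congr (act _ _); apply: val_inj.
by apply: xP; apply: map_f.
Qed.

(** An arbitrary choice, with no linearity in [m]. *)
Definition local_unit m : B := sval (cid (psmash_bact_local_unit m)).

Lemma local_unitP m : psmash_bact (local_unit m) m = m.
Proof. by rewrite /local_unit; case: cid. Qed.

Lemma psact_absorb h z x m :
  z ** x = x -> psmash_bact x m = m -> act (psact h x) m = act (psact h z) m.
Proof.
move=> zx xm; rewrite -[in RHS]xm psmash_bactE -actM; congr (act _ m).
by apply/esym/val_inj; exact: smash_act_absorb.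
Qed.

Lemma psact_indep h x y m : psmash_bact x m = m -> psmash_bact y m = m ->
  act (psact h x) m = act (psact h y) m.
Proof.
move=> xm ym; have [z zP] := left_s_unital_seq B_s_unital [:: x; y].
by rewrite (@psact_absorb h z x) ?(@psact_absorb h z y) // zP ?inE ?eqxx ?orbT.
Qed.

Lemma psmash_hact_bilinear :
  bilinear_for *:%R *:%R (fun h m => act (psact h (local_unit m)) m).
Proof.
split=> [m|h] c x y /=.
  rewrite -linearPl; congr (act _ m); apply: val_inj.
  exact: smash_act_linear.
(* A left unit [z] of both chosen local units fixes [x] and [y], hence also [c *: x + y], so a
   single element [psact h z] computes all three values. *)
have [z zP] :=
  left_s_unital_seq B_s_unital [:: local_unit x; local_unit y].
have zfix m : local_unit m \in [:: local_unit x; local_unit y] ->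
    psmash_bact z m = m.
  move=> /zP zm; rewrite -{1}(local_unitP m) !psmash_bactE -actM.
  rewrite -[RHS]local_unitP psmash_bactE; congr (act _ m).
  by apply: val_inj; rewrite [LHS]smash1M zm.
have zx : psmash_bact z x = x by apply: zfix; rewrite inE eqxx.
have zy : psmash_bact z y = y by apply: zfix; rewrite !inE eqxx orbT.
have E m : psmash_bact z m = m ->
    act (psact h (local_unit m)) m = act (psact h z) m.
  exact: psact_indep (local_unitP m).
by rewrite !E ?linearPr ?zx ?zy.
Qed.

Definition psmash_hact := bilinear_of psmash_hact_bilinear.

Lemma psmash_hactE h x m :
  psmash_bact x m = m -> psmash_hact h m = act (psact h x) m.
Proof. exact: psact_indep (local_unitP m). Qed.

Lemma psact_ps1M h g a z x : z ** a = a ->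
  psact h z ** (ps1 a ** psact g x) =
  \Delta_(h1, h2 <- h) (ps1 (P h1 a) ** psact (h2 * g) x).
Proof.
move=> za; apply: val_inj.
rewrite [RHS](linear_tlift _ _ (linearP (\val : psmash P -> smash P))).
transitivity (smash_act h z ** ((a # 1) ** smash_act g x)); first by [].
rewrite smash1_smash_act numulA smash_actM za.
rewrite [LHS](linear_tlift _ _ ((smash_mul_bilinear P).1 _)).
by apply: eq_tlift => h1 h2; rewrite [RHS]smash1_smash_act.
Qed.

Lemma psmash_partial_module : is_partial_module P psmash_bact psmash_hact.
Proof.
split.
- split=> [a b m|m].
    rewrite !psmash_bactE -actM; congr (act _ m).
    by apply: val_inj; rewrite [RHS]smash1M.
  have [x xm] := psmash_bact_local_unit m.
  by exists [:: (x, m)]; rewrite big_seq1.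
- move=> m; rewrite -[RHS]local_unitP; congr (act _ m).
  by apply: val_inj; exact: smash_act1.
move=> h g a m; have [x xm] := psmash_bact_local_unit m.
(* The outer [h] is evaluated with [z], which fixes every vector of the form [a m']; [g] and the
   [h2 * g] act on [m] itself, so [x] serves for them. *)
have [z za] := B_s_unital a.
rewrite (@psmash_hactE h z); last first.
  rewrite !psmash_bactE -actM; congr (act _ _).
  by apply: val_inj; rewrite [LHS]smash1M za.
rewrite (psmash_hactE g xm) psmash_bactE -!actM -numulA psact_ps1M //.
rewrite (linear_tlift _ _ (linearPl act m)); apply: eq_tlift => h1 h2.
by rewrite actM (psmash_hactE _ xm).
Qed.

End ModuleOfSmash.

(** * From partial modules to modules over the partial smash product *)

Section SmashOfModule.
Variables (M : lmodType k).
Variables (bact : {bilinear B -> M -> M}) (hact : {bilinear H -> M -> M}).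
Hypothesis M_partial : is_partial_module P bact hact.

Definition smash_module_act (r : smash P) (m : M) : M :=
  tlift (fun a h => bact a (hact h m)) r.

Let core_bilinear m : bilinear_for *:%R *:%R (fun a h => bact a (hact h m)).
Proof. by split=> [h|a] c x y /=; rewrite ?linearPl // linearPr. Qed.

Lemma smash_module_actE a h m :
  smash_module_act (a # h) m = bact a (hact h m).
Proof. by rewrite /smash_module_act tliftE. Qed.

Lemma smash_module_act_bilinear : bilinear_for *:%R *:%R smash_module_act.
Proof.
split=> [m|r]; first exact: tlift_linear.
move=> c m m'; rewrite -tliftP; apply: eq_tlift => a h.
by rewrite !linearPr.
Qed.

Lemma smash_module_actM r s m :
  smash_module_act (r ** s) m = smash_module_act r (smash_module_act s m).
Proof.
have sb := smash_module_act_bilinear; have mulb := smash_mul_bilinear P.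
move: r; apply: tens_eq_linear => [||a h].
- exact: linf_comp (sb.1 _) (mulb.1 _).
- exact: sb.1.
move: s; apply: tens_eq_linear => [||b g].
- exact: linf_comp (sb.1 _) (mulb.2 _).
- exact: linf_comp (sb.2 _) (sb.1 _).
rewrite [X in smash_module_act X m](smash_numulE P).
rewrite (linear_tlift _ _ (sb.1 _)) !smash_module_actE (pmodM M_partial).
rewrite (linear_tlift _ _ (linearPr bact a)); apply: eq_tlift => h1 h2.
by rewrite smash_module_actE (pmod_unital M_partial).1.
Qed.

Lemma smash_module_act_gen a h b m :
  smash_module_act (psmash_elt P a h b) m = bact a (hact h (bact b m)).
Proof.
by rewrite psmash_eltE smash_module_actM !smash_module_actE (pmod1 M_partial).
Qed.

Lemma psmash_module_act_bilinear :
  bilinear_for *:%R *:%R (fun r : psmash P => smash_module_act (psval r)).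
Proof.
by split=> [m|r] c x y /=; rewrite ?smash_module_act_bilinear.1 //
  smash_module_act_bilinear.2.
Qed.

Lemma psmash_module_act_unital :
  is_unital_left_module (bilinear_of psmash_module_act_bilinear).
Proof.
split=> [r s m|m]; first exact: smash_module_actM.
have [x xm] := unital_module_local_unit B_s_unital (pmod_unital M_partial) m.
exists [:: (psmash_gen P x 1 x, m)]; rewrite big_seq1 /=.
by rewrite [RHS]smash_module_act_gen xm (pmod1 M_partial) xm.
Qed.

End SmashOfModule.
End SmashProduct.

Theorem proposition18 (k : fieldType) (H : hopfAlgType k) (B : nuAlgType k)
    (P : partial_action H B) (B_s_unital : left_s_unital B) :
  (forall (M : lmodType k) (act : {bilinear psmash P -> M -> M}),
     is_unital_left_module act ->
     exists (bact : {bilinear B -> M -> M}) (hact : {bilinear H -> M -> M}),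
       [/\ is_partial_module P bact hact,
           forall b : B, exists2 r : psmash P,
             psval r = smash_tens P b 1 & forall m : M, bact b m = act r m,
           forall m : M, exists x : B, bact x m = m &
           forall (h : H) (m : M) (x : B), bact x m = m ->
             exists2 r : psmash P,
               psval r = \Delta_(h1, h2 <- h) smash_tens P (P h1 x) h2 &
               hact h m = act r m])
  /\
  (forall (M : lmodType k)
          (bact : {bilinear B -> M -> M}) (hact : {bilinear H -> M -> M}),
     is_partial_module P bact hact ->
     exists act : {bilinear psmash P -> M -> M},
       is_unital_left_module act /\
       forall (a b : B) (h : H) (m : M),
         act (psmash_gen P a h b) m = bact a (hact h (bact b m))).
Proof.
split=> [M act act_mod|M bact hact M_partial]; last first.
  exists (bilinear_of (psmash_module_act_bilinear P bact hact)); split.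
    exact: psmash_module_act_unital.
  by move=> a b h m; exact: smash_module_act_gen.
exists (psmash_bact B_s_unital act), (psmash_hact B_s_unital act_mod); split.
- exact: psmash_partial_module.
- by move=> b; exists (ps1 P B_s_unital b).
- exact: psmash_bact_local_unit.
- move=> h m x xm; exists (psact P B_s_unital h x) => //.
  exact: psmash_hactE.
Qed.
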